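(* An Abelian group $G$ is semi Bassian if and only if either $G \cong \mathbb{Z}(p^{\infty})$ for some prime $p$, or $G$ is a Bassian group.
   Context: All groups are Abelian, written additively. An injection between groups means an injective homomorphism. $\mathbb{Z}(p^\infty)$ is the quasi-cyclic (Prüfer) $p$-group. A subgroup $E$ of $G$ is essential in $G$ if $E \cap S \neq \{0\}$ for every non-zero subgroup $S$ of $G$. A group $G$ is Bassian if, for every subgroup $N \leq G$, the existence of an injection $G \to G/N$ implies $N = \{0\}$. A group $G$ is semi Bassian if, for every subgroup $N \leq G$, the existence of an injection $G \to G/N$ implies that either $N = \{0\}$ or $N$ is essential in $G$. *)

(* Defs.v *)
From HB Require Import structures.
From mathcomp Require Import all_boot all_order all_algebra.
From mathcomp Require Import ring.
Set Implicit Arguments.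
Unset Strict Implicit.
Unset Printing Implicit Defensive.
Import GRing.Theory Num.Theory.
Local Open Scope ring_scope.

(* A subgroup of [G] is a [zmodClosed G], whose underlying predicate is
   boolean.  Since classical logic and indefinite description are admitted,
   every [Prop]-valued subgroup has the same elements as one of these.  The
   quotient G/N is the library's [Quotient.quot N]. *)

Definition is_zero_subset (G : zmodType) (A : {pred G}) : Prop :=
  forall x : G, x \in A <-> x = 0.

Definition has_injection (G H : zmodType) : Prop :=
  exists f : {additive G -> H}, injective f.

Definition isomorphic (G H : zmodType) : Prop :=
  exists f : {additive G -> H}, bijective f.

Definition essential (G : zmodType) (E : zmodClosed G) : Prop :=
  forall S : zmodClosed G,
    ~ is_zero_subset S -> ~ is_zero_subset [predI E & S].

Definition bassian (G : zmodType) : Prop :=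
  forall N : zmodClosed G,
    has_injection G (Quotient.quot N) -> is_zero_subset N.

Definition semi_bassian (G : zmodType) : Prop :=
  forall N : zmodClosed G,
    has_injection G (Quotient.quot N) -> is_zero_subset N \/ essential N.

(* The quasi-cyclic group Z(p^oo) is realized as Z[1/p] / Z, where Z[1/p] is
   the group of rationals whose reduced denominator is a power of p.  Only p
   prime is meaningful; otherwise [prufer p] is not a quasi-cyclic group. *)

Definition pow_denom (p : nat) (x : rat) : bool := p.-nat `|denq x|%N.

Lemma pow_denom_zmod_closed p : zmod_closed (pow_denom p).
Proof.
split=> [|x y]; rewrite unfold_in /pow_denom ?denq_int //.
rewrite [y \in _]unfold_in /pow_denom [_ \in _]unfold_in => px py.
have dvd : (absz (denq (x - y)) %| absz (denq x) * absz (denq y))%N.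
  rewrite -(@Gauss_dvdr _ (absz (numq (x - y)))); last first.
    by rewrite coprime_sym coprime_num_den.
  apply/dvdnP; exists (absz (numq x * denq y - numq y * denq x)%R).
  rewrite -!abszM; congr absz; apply/(@intr_inj rat).
  by rewrite !(rmorphM, rmorphB) /= !numqE; ring.
by apply: pnat_dvd dvd _; rewrite pnatM px.
Qed.

HB.instance Definition _ (p : nat) :=
  GRing.isZmodClosed.Build rat (pow_denom p) (pow_denom_zmod_closed p).

Record Zinv (p : nat) := MkZinv {
  Zinv_val :> rat;
  Zinv_valP : Zinv_val \in pow_denom p
}.

HB.instance Definition _ (p : nat) := [isSub for @Zinv_val p].
HB.instance Definition _ (p : nat) := [Choice of Zinv p by <:].
HB.instance Definition _ (p : nat) :=
  [SubChoice_isSubZmodule of Zinv p by <:].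

Definition Zinv_int (p : nat) (x : Zinv p) : bool := val x \is a Num.int.

Lemma Zinv_int_zmod_closed p : zmod_closed (@Zinv_int p).
Proof.
split=> [|x y]; rewrite ![_ \in _]unfold_in /Zinv_int ?raddf0 ?raddfB.
  exact: rpred0.
exact: rpredB.
Qed.

HB.instance Definition _ (p : nat) :=
  GRing.isZmodClosed.Build (Zinv p) (@Zinv_int p) (@Zinv_int_zmod_closed p).

Definition prufer (p : nat) : zmodType :=
  Quotient.quot (GRing.ZmodClosed.clone (Zinv p) (@Zinv_int p) _).

(* Main.v *)
(* Suppose [f : G -> G/N] is injective and [N <> 0].  Lifting the iterates of [f]
   at some [0 <> x] in [N] produces infinitely many elements of [G]: independent
   ones if [x] has infinite order, distinct p-power torsion ones if [x] has order
   [p].  In the first case, and also whenever the socle G[p] is infinite, [G]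
   contains an infinite direct sum [<y_0> + B] with [B] a sum of cyclic groups that
   both embeds in and maps onto a group [D] to which homomorphisms from [B] can be
   extended; then [G] embeds in [G/N'] where [N'] is the kernel of [B -> D], and
   [N'] misses [y_0], so [G] is not semi Bassian.  What remains is an infinite
   p-torsion subgroup with finite socle; it contains a copy [P] of Z(p^oo), [G]
   embeds in [G/P[p]], and essentiality of [P[p]] forces [G = P]. *)

Require Import Defs.
From HB Require Import structures.
From mathcomp Require Import all_boot all_order all_algebra.
From mathcomp Require Import zify ring boolp classical_sets.
Set Implicit Arguments.
Unset Strict Implicit.
Unset Printing Implicit Defensive.
Import Order.TTheory GRing.Theory Num.Theory.
Local Open Scope quotient_scope.
Local Open Scope ring_scope.

(** * Extending homomorphisms *)

Lemma zmodClosed_of_prop (G : zmodType) (P : G -> Prop) :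
  P 0 -> (forall x y, P x -> P y -> P (x - y)) ->
  exists N : zmodClosed G, forall x, x \in N <-> P x.
Proof.
move=> P0 PB.
pose A : {pred G} := fun x => `[< P x >].
have AP : zmod_closed A.
  split=> [|x y]; first exact/asboolP.
  by move=> /asboolP Px /asboolP Py; apply/asboolP/PB.
pose AM := GRing.isZmodClosed.Build G A AP.
pose N : zmodClosed G := HB.pack A AM.
by exists N => x; split=> /asboolP.
Qed.

Lemma additive_of_morph (G H : zmodType) (f : G -> H) :
  {morph f : x y / x - y} -> exists F : {additive G -> H}, F =1 f.
Proof.
move=> fB.
pose fM := GRing.isZmodMorphism.Build G H f fB.
pose F : {additive G -> H} := HB.pack f fM.
by exists F.
Qed.

Lemma pi_quot_eq (G : zmodType) (N : zmodClosed G) x y :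
  \pi_(Quotient.quot N) x = \pi_(Quotient.quot N) y <-> x - y \in N.
Proof. by rewrite Quotient.idealrBE; split=> /eqP. Qed.

Lemma pi_quot_eq0 (G : zmodType) (N : zmodClosed G) x :
  \pi_(Quotient.quot N) x = 0 <-> x \in N.
Proof. by rewrite -(raddf0 (\pi_(Quotient.quot N))) pi_quot_eq subr0. Qed.

(* For [q = 0] (every [n] divides 0, and [0 %/ n = 0]) this is divisibility; for
   [q > 0] it is Baer's criterion over Z/qZ, without requiring [q D = 0]. *)
Definition mod_injective (q : nat) (D : zmodType) : Prop :=
  forall n : nat, (0 < n)%N -> (n %| q)%N ->
  forall d : D, d *+ (q %/ n) = 0 -> exists e, d = e *+ n.

Section Extension.

Variables (q : nat) (G D : zmodType).
Hypothesis injD : mod_injective q D.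

(** Homomorphisms on subgroups are encoded by their graphs, so that extension is inclusion and
    Zorn's lemma applies; the last clause is single-valuedness. *)
Definition partial_hom (X : set (G * D)) : Prop :=
  [/\ X (0, 0),
      forall x y c d, X (x, c) -> X (y, d) -> X (x - y, c - d)
    & forall d, X (0, d) -> d = 0].

Lemma partial_hom_mulrz X x c (k : int) :
  partial_hom X -> X (x, c) -> X (x *~ k, c *~ k).
Proof.
case=> X0 XB _ Xc.
have XN y d : X (y, d) -> X (- y, - d).
  by move=> Xd; rewrite -[- y]sub0r -[- d]sub0r; apply: XB.
have Xn n : X (x *+ n, c *+ n).
  elim: n => [|n IHn]; rewrite ?mulr0n //.
  rewrite !mulrS -[x *+ n]opprK -[c *+ n]opprK.
  exact/XB/XN.
by case: k => n; rewrite ?NegzE ?mulrNz; [|apply: XN]; apply: Xn.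
Qed.

Lemma partial_hom_eq X x c d :
  partial_hom X -> X (x, c) -> X (x, d) -> c = d.
Proof.
case=> _ XB X1 Xc Xd; apply/subr0_eq/X1.
by rewrite -(subrr x); apply: XB.
Qed.

(** Baer's argument: the [k] with [x *~ k] in the domain form an ideal of Z containing [q]. If
    [n > 0] generates it, then [n] divides [q], the value [d] at [x *+ n] is killed by [q %/ n], and
    [e] is a quotient of [d] by [n]. *)
Lemma partial_hom_slope X (x : G) :
    partial_hom X -> (forall g, X (g *+ q, 0)) ->
  exists e : D, forall (k : int) c, X (x *~ k, c) -> c = e *~ k.
Proof.
move=> pX Xq; have [X0 XB X1] := pX.
pose P n := `[< (0 < n)%N /\ exists c, X (x *+ n, c) >].
have Psub k c : X (x *~ k, c) -> (k == 0) || P `|k|%N.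
  move=> Xk; have [//|k0] := eqVneq k 0.
  apply/asboolP; split; first by rewrite lt0n absz_eq0.
  case: k Xk k0 => n; first by move=> Xk _; exists c.
  rewrite NegzE mulrNz => Xk _; exists (- c).
  by have := XB _ _ _ _ X0 Xk; rewrite !sub0r opprK.
have [exP|nP] := pselect (exists n, P n); last first.
  (* Only [k = 0] can occur here, so any slope works. *)
  exists 0 => k c Xk; have := Psub _ _ Xk.
  case/orP=> [/eqP k0|Pk]; last by case: nP; exists `|k|%N.
  by rewrite mul0rz; move: Xk; rewrite k0 mulr0z => /X1.
have [n /asboolP[n0 [d Xd]] nmin] := ex_minnP exP.
have dvd k c : X (x *~ k, c) -> k = (k %/ n)%Z * n%:Z.
  move=> Xk; have kE := divz_eq k n; rewrite {1}kE.
  suff -> : (k %% n)%Z = 0 by rewrite addr0.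
  have n0' : n%:Z != 0 by lia.
  have rge := modz_ge0 k n0'.
  have rlt : (k %% n)%Z < n%:Z by apply: ltz_pmod; lia.
  have Xr : X (x *~ (k %% n)%Z, c - d *~ (k %/ n)%Z).
    have -> : (k %% n)%Z = k - n%:Z * (k %/ n)%Z by lia.
    rewrite mulrzBr mulrzA; apply: XB => //.
    exact: partial_hom_mulrz.
  have [//|r0] := eqVneq (k %% n)%Z 0.
  have := Psub _ _ Xr; rewrite (negPf r0) /= => /nmin; lia.
have nq : (n %| q)%N.
  have := dvd q 0 (Xq x) => qE; apply/dvdnP.
  by exists `|(q %/ n)%Z|%N; lia.
have [e dE] : exists e, d = e *+ n.
  apply: (injD n0 nq); apply: (partial_hom_eq pX _ (Xq x)).
  rewrite -{1}(divnK nq) mulnC mulrnA.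
  exact: (partial_hom_mulrz (q %/ n)%N pX Xd).
exists e => k c Xk; rewrite (dvd _ _ Xk) mulrC mulrzA -pmulrn -dE.
apply: (partial_hom_eq pX Xk); rewrite [in x *~ k](dvd _ _ Xk) mulrC mulrzA.
exact: partial_hom_mulrz.
Qed.

Lemma partial_hom_extend X x : partial_hom X -> (forall g, X (g *+ q, 0)) ->
  exists2 Y, partial_hom Y & (X `<=` Y)%classic /\ exists e, Y (x, e).
Proof.
move=> pX Xq; have [X0 XB X1] := pX.
have [e eP] := partial_hom_slope x pX Xq.
exists (fun u => exists s c (k : int), [/\ X (s, c), u.1 = s + x *~ k
  & u.2 = c + e *~ k]).
  split.
  - by exists 0, 0, 0; rewrite !mulr0z !addr0.
  - move=> y z a b [s [c [k [/= Xs -> ->]]]] [t [d [l [/= Xt -> ->]]]].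
    exists (s - t), (c - d), (k - l); split; first exact: XB.
      by rewrite mulrzBr /= opprD addrACA.
    by rewrite mulrzBr /= opprD addrACA.
  - move=> d [s [c [k [/= Xs /eqP]]]].
    rewrite eq_sym addr_eq0 => /eqP sE ->.
    rewrite -[e *~ k](eP k (- c)) ?subrr //.
    by have := XB _ _ _ _ X0 Xs; rewrite sE !sub0r opprK.
split; last by exists e, 0, 0, 1; rewrite !add0r.
by move=> [y c] Xy; exists y, c, 0; rewrite !mulr0z !addr0.
Qed.

End Extension.

Lemma extend_additive (q : nat) (A G D : zmodType) (Y : {additive A -> G})
    (h : {additive A -> D}) :
    mod_injective q D -> (forall a g, Y a = g *+ q -> h a = 0) ->
  exists H : {additive G -> D}, forall a, H (Y a) = h a.
Proof.
move=> injD hY.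
(* Prescribing the value 0 on [qG] as well gives every larger graph the second hypothesis of
   [partial_hom_slope]. *)
pose R0 : set (G * D) := fun u => exists a g, u = (Y a + g *+ q, h a).
(* Only nonempty sets are constrained, because the union of the empty chain is empty. *)
pose P (X : set (G * D)) :=
  (exists u, X u) -> partial_hom X /\ (R0 `<=` X)%classic.
have pR0 : partial_hom R0.
  split.
  - by exists 0, 0; rewrite !raddf0 mul0rn addr0.
  - move=> x y c d [a [g [-> ->]]] [b [h' [-> ->]]].
    by exists (a - b), (g - h'); rewrite !raddfB mulrnBl opprD addrACA.
  - move=> d [a [g [/eqP]]]; rewrite eq_sym addr_eq0 -mulNrn => /eqP.
    by move=> /hY <-.
have [F FP totF|M [PM Mmax]] := @Zorn_bigcup _ P.
  move=> [u [X FX Xu]].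
  have good Z v : F Z -> Z v -> partial_hom Z /\ (R0 `<=` Z)%classic.
    by move=> FZ Zv; apply: (FP Z FZ); exists v.
  have [[X0 XB X1] RX] := good X u FX Xu.
  split; last by move=> v /RX Xv; exists X.
  split; first by exists X.
    move=> x y c d [Z FZ Zx] [W FW Wy].
    have [[_ ZB _] _] := good _ _ FZ Zx; have [[_ WB _] _] := good _ _ FW Wy.
    case: (totF _ _ FZ FW) => [ZW|WZ]; first by exists W => //; apply/WB/Wy/ZW.
    by exists Z => //; apply: ZB => //; apply: WZ.
  move=> d [Z FZ Zd]; have [[_ _ Z1] _] := good _ _ FZ Zd; exact: Z1.
have [[u Mu]|M0] := pselect (exists u, M u); last first.
  case: (Mmax R0); last by move=> _; split.
  split; first by move=> u Mu; case: M0; exists u.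
  by move=> RM; apply: M0; exists (0, 0); apply: RM; case: pR0.
have [pM RM] := PM (ex_intro _ u Mu).
have Mq g : M (g *+ q, 0) by apply: RM; exists 0, g; rewrite !raddf0 add0r.
have tot x : exists c, M (x, c).
  have [Z pZ [MZ [e Ze]]] := partial_hom_extend injD x pM Mq.
  exists e; apply: contrapT => nM; apply: (Mmax Z); last first.
    by move=> _; split=> // v /RM /MZ.
  by split=> // ZM; apply/nM/ZM.
have [f fP] := choice tot.
have [|H HE] := @additive_of_morph G D f.
  move=> x y; apply: (partial_hom_eq pM (fP _)); case: pM => _ MB _.
  exact: MB.
exists H => a; rewrite HE; apply: (partial_hom_eq pM (fP _)).
by apply: RM; exists a, 0; rewrite mul0rn addr0.
Qed.

(* [psi x = pi (sigma (Phi x - Theta x) + x)], with [sigma] a section of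
   [Theta] valued in [Y A]; since [Theta] factors through [G/N] and sends
   [psi x] to [Phi x], the kernel of [psi] lies in [ker Phi] meet [Y A]. *)
Lemma embeds_in_quotient (A G D : zmodType) (Y : {additive A -> G})
    (Phi Theta : {additive G -> D}) (N : zmodClosed G) :
    (forall d, exists a, Theta (Y a) = d) ->
    (forall a, Phi (Y a) = 0 -> Y a = 0) ->
    (forall x, x \in N <-> exists2 a, x = Y a & Theta x = 0) ->
  has_injection G (Quotient.quot N).
Proof.
move=> onto inj NE; have [s sP] := choice onto.
pose psi x := \pi_(Quotient.quot N) (Y (s (Phi x - Theta x)) + x).
(* The section [s] need not be additive, but [Theta] kills the image under [Y] of its defect, which
   therefore lies in [N]. *)
have psiB : {morph psi : x y / x - y}.
  move=> x y; rewrite /psi -raddfB; apply/pi_quot_eq/NE.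
  have collect (b c d : G) : b + (x - y) - (c + x - (d + y)) = b - (c - d).
    by rewrite (opprD d) (addrACA c) (opprD (c - d)) addrACA subrr addr0.
  rewrite collect.
  exists (s (Phi (x - y) - Theta (x - y))
    - (s (Phi x - Theta x) - s (Phi y - Theta y))).
    by rewrite !raddfB.
  rewrite 2!(raddfB Theta (Y _)) !sP (raddfB Phi) (raddfB Theta) (opprD (Phi y)).
  by rewrite (addrACA (Phi x) (- Theta x)) -(opprD (Theta x)) subrr.
have [Psi PsiE] := additive_of_morph psiB.
exists Psi; apply: raddf_inj => x; rewrite PsiE => /pi_quot_eq0/NE [a xE].
rewrite raddfD /= sP subrK => Phi0.
have xY : x = Y (a - s (Phi x - Theta x)).
  by rewrite raddfB -xE addrAC subrr add0r.
by rewrite xY inj // -xY.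
Qed.

(** * Independent sequences *)

(** [{poly int}] serves as the free Abelian group on the powers of ['X]: multiplication by ['X]
    shifts the sequence, and the constant term isolates its first entry. *)
Definition lincomb (G : zmodType) (y : nat -> G) (f : {poly int}) : G :=
  \sum_(i < size f) y i *~ f`_i.

Lemma lincombE (G : zmodType) (y : nat -> G) (f : {poly int}) n :
  (size f <= n)%N -> lincomb y f = \sum_(i < n) y i *~ f`_i.
Proof.
move=> le_f_n; rewrite /lincomb (big_ord_widen n (fun i => y i *~ f`_i)) //.
rewrite big_mkcond /=; apply: eq_bigr => i _.
by case: ltnP => // /(nth_default 0) ->; rewrite mulr0z.
Qed.

Lemma lincomb_is_zmod_morphism (G : zmodType) (y : nat -> G) :
  zmod_morphism (lincomb y).
Proof.
move=> f g; pose n := maxn (size f) (size g).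
rewrite !(@lincombE _ _ _ n) ?leq_maxl ?leq_maxr //; last first.
  by rewrite (leq_trans (size_polyD _ _)) ?size_polyN.
by rewrite -sumrB; apply: eq_bigr => i _; rewrite coefB mulrzBr.
Qed.

HB.instance Definition _ (G : zmodType) (y : nat -> G) :=
  GRing.isZmodMorphism.Build {poly int} G (lincomb y)
    (lincomb_is_zmod_morphism y).

Lemma lincombX (G : zmodType) (y : nat -> G) i : lincomb y 'X^i = y i.
Proof.
rewrite /lincomb size_polyXn big_ord_recr /= coefXn eqxx big1 ?add0r // => j _.
by rewrite coefXn ltn_eqF.
Qed.

Lemma lincombC (G : zmodType) (y : nat -> G) k : lincomb y k%:P = y 0%N *~ k.
Proof.
by rewrite (@lincombE _ _ _ 1) ?size_polyC_leq1 // big_ord1 coefC.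
Qed.

Lemma lincombMX (G : zmodType) (y : nat -> G) f :
  lincomb y (f * 'X) = lincomb (y \o S) f.
Proof.
rewrite (@lincombE _ _ _ (size f).+1); last first.
  by rewrite (leq_trans (size_polyMleq _ _)) // size_polyX addn2.
rewrite big_ord_recl coefMX mulr0z add0r; apply: eq_bigr => i _.
by rewrite coefMX.
Qed.

Lemma mulrz_dvd (G : zmodType) (x : G) (n : nat) (k : int) :
  x *+ n = 0 -> (n %| k)%Z -> x *~ k = 0.
Proof. by move=> xn /dvdzP[m ->]; rewrite mulrC mulrzA -pmulrn xn mul0rz. Qed.

Lemma lincomb_dvd (G : zmodType) (y : nat -> G) (o : nat -> nat)
    (f : {poly int}) :
  (forall i, y i *+ o i = 0) -> (forall i, (o i %| f`_i)%Z) -> lincomb y f = 0.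
Proof. by move=> yo od; rewrite /lincomb big1 // => i _; apply: mulrz_dvd. Qed.

(* [y] is independent modulo [qG], its entries having orders [o]
   (order 0 meaning infinite order). *)
Definition indep_mod (q : nat) (G : zmodType) (y : nat -> G) (o : nat -> nat) :=
  (forall i, y i *+ o i = 0) /\
  forall f g, lincomb y f = g *+ q -> forall i, (o i %| f`_i)%Z.

(* [B = <y_1, y_2, ...>] maps both injectively into [D] (by [z]) and onto [D]
   (by [w]); the kernel [N] of the latter meets [<y_0>] trivially. *)
Lemma not_semi_bassian_of_indep (q : nat) (G D : zmodType)
    (y : nat -> G) (z w : nat -> D) (o : nat -> nat) :
    mod_injective q D -> (forall i, o i <> 1%N) -> indep_mod q y o ->
    (forall i, z i *+ o i.+1 = 0) ->
    (forall f, lincomb z f = 0 -> forall i, (o i.+1 %| f`_i)%Z) ->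
    (forall i, w i *+ o i.+1 = 0) -> (forall d, exists i, w i = d) ->
  ~ semi_bassian G.
Proof.
move=> injD o1 [yo yindep] zo zindep wo wonto sbG.
pose Y : {additive {poly int} -> G} := lincomb (y \o S).
have YE f : Y f = lincomb y (f * 'X) by rewrite lincombMX.
have Ydvd f g : Y f = g *+ q -> forall i, (o i.+1 %| f`_i)%Z.
  by rewrite YE => /yindep fo i; have := fo i.+1; rewrite coefMX.
have [Phi PhiE] : exists H : {additive G -> D}, forall f, H (Y f) = lincomb z f.
  apply: (extend_additive injD) => f g /Ydvd fo.
  exact: lincomb_dvd zo fo.
have [Theta ThetaE] : exists H : {additive G -> D}, forall f, H (Y f) = lincomb w f.
  apply: (extend_additive injD) => f g /Ydvd fo.
  exact: lincomb_dvd wo fo.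
have y_neq0 i : y i <> 0.
  move=> yi0; have := yindep 'X^i 0; rewrite lincombX yi0 mul0rn.
  by move=> /(_ (erefl _) i); rewrite coefXn eqxx dvdz1 => /eqP /o1.
have [|x x'|N NE] :=
    @zmodClosed_of_prop G (fun x => exists2 f, x = Y f & Theta x = 0).
- by exists 0; rewrite !raddf0.
- move=> [f -> Tf] [g -> Tg]; exists (f - g); first by rewrite raddfB.
  by rewrite raddfB Tf Tg subrr.
have : has_injection G (Quotient.quot N).
  apply: (embeds_in_quotient (Y := Y) (Phi := Phi) (Theta := Theta)) => //.
    by move=> d; have [i <-] := wonto d; exists 'X^i; rewrite ThetaE lincombX.
  move=> f; rewrite PhiE => /zindep fo; apply: (lincomb_dvd _ fo) => i.
  exact: yo.
case/sbG => [N0|essN].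
  (* An index where [w] vanishes puts a nonzero entry of [y] into [N]. *)
  have [i wi] := wonto 0; apply: (y_neq0 i.+1); apply/N0/NE.
  have yE : y i.+1 = Y 'X^i by rewrite YE -exprSr lincombX.
  by exists 'X^i => //; rewrite yE ThetaE lincombX.
have [|x x'|S0 SE] := @zmodClosed_of_prop G (fun x => exists k, x = y 0%N *~ k).
- by exists 0; rewrite mulr0z.
- by move=> [k ->] [l ->]; exists (k - l); rewrite mulrzBr.
apply: (essN S0).
  by move=> S00; apply: (y_neq0 0%N); apply/S00/SE; exists 1.
move=> x; split=> [|->]; last by rewrite inE !rpred0.
rewrite inE => /andP[/NE[f xf _] /SE[k xk]].
(* A common element of [<y_0>] and [N] is a relation whose constant coefficient [k] must kill
   [y 0]. *)
have : lincomb y (k%:P - f * 'X) = 0 *+ q.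
  by rewrite raddfB /= lincombC -YE -xk -xf subrr mul0rn.
move/yindep/(_ 0%N); rewrite coefB coefMX coefC /= subr0 => ok.
by rewrite xk; apply: mulrz_dvd ok.
Qed.

(* A relation is killed from the top: its last coefficient multiplies [y_i]
   into the span of the previous entries. *)
Lemma indep_mod_of_step (q : nat) (G : zmodType) (y : nat -> G) (o : nat -> nat) :
    (forall i, y i *+ o i = 0) ->
    (forall i (n : int) (c : nat -> int) g,
       y i *~ n = \sum_(j < i) y j *~ c j + g *+ q -> (o i %| n)%Z) ->
  indep_mod q y o.
Proof.
move=> yo step; split=> // f g; rewrite /lincomb => fE i.
have [le_f_i|lt_i_f] := leqP (size f) i; first by rewrite nth_default ?dvdz0.
elim: (size f) fE lt_i_f => // n IHn; rewrite big_ord_recr /= => fE.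
have on : (o n %| f`_n)%Z.
  apply: (step n _ (fun j => - f`_j) g).
  rewrite (eq_bigr (fun j : 'I_n => - (y j *~ f`_j))); last first.
    by move=> j _; rewrite mulrNz.
  by rewrite sumrN -fE addKr.
rewrite ltnS leq_eqVlt => /orP[/eqP -> //|]; apply: IHn.
by rewrite -fE (mulrz_dvd _ on) ?addr0.
Qed.

(** * Countable targets for the three kinds of independent sequence *)

Lemma coef_lincomb_scaleX (R : nzRingType) (c : nat -> R) (f : {poly int}) i :
  (lincomb (fun i => c i *: 'X^i) f)`_i = c i *~ f`_i.
Proof.
rewrite /lincomb coef_sum.
rewrite (eq_bigr (fun j : 'I_(size f) => if i == j then c i *~ f`_i else 0)).
  have [le_f_i|lt_i_f] := leqP (size f) i.
    rewrite big1 ?nth_default ?mulr0z // => j _.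
    by rewrite gtn_eqF // (leq_trans _ le_f_i).
  by rewrite -big_mkcond (big_pred1 (Ordinal lt_i_f)).
move=> j _; rewrite coefMrz coefZ coefXn.
by case: eqP => [->|_]; rewrite ?mulr1 // mulr0 mul0rz.
Qed.

Lemma mod_injective_poly_rat : mod_injective 0 {poly rat}.
Proof.
move=> n n0 _ d _; exists (n%:R^-1 *: d).
by rewrite -scaler_nat scalerA divff ?scale1r // pnatr_eq0 -lt0n.
Qed.

(** The target [{poly rat}] is divisible, contains the independent powers of ['X], and is countable;
    infinite orders put no constraint on [w], so an enumeration serves. *)
Lemma not_semi_bassian_of_torsion_free (G : zmodType) (y : nat -> G) :
  indep_mod 0 y (fun=> 0%N) -> ~ semi_bassian G.
Proof.
move=> yindep.
apply: (not_semi_bassian_of_indep (z := fun i => 1 *: 'X^i)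
  (w := fun i => odflt 0 (unpickle i)) mod_injective_poly_rat _ yindep) => //.
- move=> f f0 i; have := coef_lincomb_scaleX (fun=> 1 : rat) f i.
  by rewrite f0 coef0 => /esym/eqP; rewrite intr_eq0 => /eqP ->.
- by move=> d; exists (pickle d); rewrite pickleK.
Qed.

(* The polynomials with coefficients in the localization of Z at [p]. *)
Definition local_poly (p : nat) (f : {poly rat}) : Prop :=
  exists n (g : {poly int}), coprime p n /\ f *+ n = map_poly intr g.

Lemma local_poly_map_intr p (g : {poly int}) : local_poly p (map_poly intr g).
Proof. by exists 1%N, g; rewrite coprimen1 mulr1n. Qed.

Lemma local_polyB p f g : local_poly p f -> local_poly p g -> local_poly p (f - g).
Proof.
move=> [n [f' [pn fE]]] [m [g' [pm gE]]].
exists (n * m)%N, (f' *+ m - g' *+ n); rewrite coprimeMr pn pm; split=> //.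
by rewrite rmorphB !rmorphMn /= -fE -gE -!mulrnA [(m * n)%N]mulnC -mulrnBl.
Qed.

Lemma clear_denominators (f : {poly rat}) :
  exists n (g : {poly int}), (0 < n)%N /\ f *+ n = map_poly intr g.
Proof.
have [g [a a0 ->]] := rat_poly_scale f.
have [a_ge0|a_lt0] := lerP 0 a; [exists `|a|%N, g | exists `|a|%N, (- g)].
  rewrite absz_gt0; split=> //; rewrite -scaler_nat scalerA [_%:R]pmulrn.
  by rewrite gez0_abs // divff ?scale1r ?intr_eq0.
rewrite absz_gt0; split=> //; rewrite -scaler_nat scalerA [_%:R]pmulrn.
by rewrite ltz0_abs // mulrNz mulNr divff ?intr_eq0 // scaleN1r raddfN.
Qed.

Section Torsion.

Variable p : nat.
Hypothesis p_pr : prime p.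

(** The target is Q[X] modulo polynomials over Z localized at [p], a countable direct sum of copies
    of Z(p^oo). It is divisible, and the class of ['X^i] divided by [p ^ i.+2] has the order of
    [y i.+1]. *)
Lemma not_semi_bassian_of_unbounded (G : zmodType) (y : nat -> G) :
  indep_mod 0 y (fun i => p ^ i.+1)%N -> ~ semi_bassian G.
Proof.
move=> yindep.
have [||M ME] := @zmodClosed_of_prop _ (local_poly p).
- by rewrite -(raddf0 (map_poly intr)); apply: local_poly_map_intr.
- by move=> f g; apply: local_polyB.
pose D := Quotient.quot M.
pose pi : {additive {poly rat} -> D} := \pi_(Quotient.quot M).
have pi0 f : pi f = 0 <-> local_poly p f.
  by split=> [/pi_quot_eq0/ME|/ME/pi_quot_eq0].
have piK (d : D) : pi (repr d) = d by apply: reprK.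
have injD : mod_injective 0 D.
  move=> n n0 n_dvd d _.
  have [|e dE] := mod_injective_poly_rat n0 n_dvd (d := repr d).
    by rewrite div0n.
  by exists (pi e); rewrite -raddfMn -dE piK.
have tors (d : D) : exists k, d *+ (p ^ k)%N = 0.
  have [n [g [n0 dn]]] := clear_denominators (repr d).
  (* The [p]-part of [n] kills [d], since the remaining factor is an admissible denominator. *)
  exists (logn p n); rewrite -[d]piK -raddfMn; apply/pi0.
  exists (n`_p^')%N, g; rewrite -mulrnA -p_part partnC //; split=> //.
  by rewrite coprime_sym (p'nat_coprime (part_pnat _ _)) ?pnat_id.
pose c i : rat := (p ^ i.+2)%N%:R^-1.
have p_neq0 k : (p ^ k)%N%:R != 0 :> rat.
  by rewrite pnatr_eq0 -lt0n expn_gt0 prime_gt0.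
(* As [w i] must be killed by [p ^ i.+2], each [d] has to recur at large indices. The 2-adic
   valuation of [i.+1] codes the value; the odd factor, later [k.*2.+1], pushes the index beyond the
   exponent [k] of [d]. *)
pose u i := pi (odflt 0 (unpickle (logn 2 i.+1))).
apply: (not_semi_bassian_of_indep (z := fun i => pi (c i *: 'X^i))
  (w := fun i => if u i *+ (p ^ i.+2)%N == 0 then u i else 0) injD _ yindep).
- by move=> i /eqP; rewrite -[1%N](expn0 p) eqn_exp2l ?prime_gt1.
- move=> i; rewrite -raddfMn -scaler_nat scalerA divff // scale1r.
  by apply/pi0; rewrite -(map_polyXn intr); apply: local_poly_map_intr.
- move=> f f0 i; have /pi0[n [g [pn]]] :
      pi (lincomb (fun i => c i *: 'X^i) f) = 0.
    rewrite -f0 raddf_sum; apply: eq_bigr => j _; exact: raddfMz.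
  move=> /(congr1 (fun h : {poly rat} => h`_i)).
  rewrite coefMn coef_lincomb_scaleX  coef_map /= => kE.
  have {kE} kE : f`_i * n%:Z = g`_i * (p ^ i.+2)%N%:Z.
    apply: (@intr_inj rat); rewrite !intrM -kE.
    rewrite -mulr_natr -[c i *~ _]mulrzl mulrAC -[_ * c i * _]mulrA mulVf ?mulr1 //.
  rewrite -(@Gauss_dvdzl _ _ n); last by rewrite coprimezE coprimeXl.
  by rewrite kE dvdz_mull.
- by move=> i; case: eqP => // _; rewrite mul0rn.
- move=> d; have [k dk] := tors d; pose a := pickle (repr d).
  exists (2 ^ a * k.*2.+1).-1.
  have lt0 : (0 < 2 ^ a * k.*2.+1)%N by rewrite muln_gt0 expn_gt0.
  have -> : u (2 ^ a * k.*2.+1).-1 = d.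
    rewrite /u prednK // lognM ?expn_gt0 // pfactorK //.
    by rewrite (@lognE _ k.*2.+1) /= dvdn2 /= odd_double /= addn0 pickleK piK.
  case: eqP => // - []; set N := _.+2.
  have kN : (k <= N)%N by rewrite /N prednK //; nia.
  by rewrite -(subnKC kN) expnD mulrnA dk mul0rn.
Qed.

Lemma intr_Zp_eq0 q (k : int) :
  (1 < q)%N -> k%:~R = 0 :> 'Z_q -> (q %| k)%Z.
Proof.
move=> q1; rewrite {1}(divz_eq k q) rmorphD rmorphM /= -[q%:~R]pmulrn.
rewrite pchar_Zp // mulr0 add0r => kq0; apply/dvdz_mod0P.
have [r rE] : exists r : nat, (k %% q)%Z = r.
  by exists `|(k %% q)%Z|%N; rewrite gez0_abs // modz_ge0; lia.
have : (k %% q)%Z < q by apply: ltz_pmod; lia.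
move: kq0; rewrite rE => /(congr1 val); rewrite /= val_Zp_nat // => r0.
by rewrite ltz_nat => /modn_small <-; rewrite r0.
Qed.

(** The target is a countable sum of copies of Z/qZ, where [q = p ^ m.+1]. It is injective over
    Z/qZ, and [q] kills it, so any enumeration is admissible as [w]. *)
Lemma not_semi_bassian_of_bounded (G : zmodType) (y : nat -> G) m :
  indep_mod (p ^ m.+1) y (fun=> p ^ m.+1)%N -> ~ semi_bassian G.
Proof.
move=> yindep; pose q := (p ^ m.+1)%N.
have q1 : (1 < q)%N by rewrite -[1%N](expn0 p) ltn_exp2l ?prime_gt1.
have q0 : q%:R = 0 :> {poly 'Z_q}.
  by rewrite -polyC_natr char_Zp.
have injD : mod_injective q {poly 'Z_q}.
  move=> n n0 nq d d0.
  (* Since [q = n * (q %/ n)], the natural representative of each coefficient is a multiple of [n]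
     and can be divided in [nat]. *)
  have dn i : (n %| (d`_i)%R)%N.
    have : d`_i *+ (q %/ n) = 0 by rewrite -coefMn d0 coef0.
    rewrite -{1}[d`_i]natr_Zp -mulrnA => /(congr1 val); rewrite /= val_Zp_nat //.
    move=> /eqP; rewrite -[_ == _]/(q %| _)%N; move: (nat_of_ord _) => k.
    rewrite -{1}(divnK nq) [(k * _)%N]mulnC dvdn_pmul2l //.
    by rewrite divn_gt0 // dvdn_leq // ltnW.
  exists (\poly_(i < size d) ((d`_i)%R %/ n)%N%:R).
  apply/polyP => i; rewrite coefMn coef_poly.
  case: ltnP => [_|/(nth_default 0) ->]; last by rewrite mul0rn.
  by rewrite -mulrnA divnK // natr_Zp.
have tors (d : {poly 'Z_q}) : d *+ q = 0 by rewrite -mulr_natr q0 mulr0.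
apply: (not_semi_bassian_of_indep (z := fun i => 1 *: 'X^i)
  (w := fun i => odflt 0 (unpickle i)) injD _ yindep) => //.
- by move=> _ q_1; rewrite /q q_1 in q1.
- move=> f f0 i; have := coef_lincomb_scaleX (fun=> 1 : 'Z_q) f i.
  by rewrite f0 coef0 => /esym; apply: intr_Zp_eq0.
- by move=> d; exists (pickle d); rewrite pickleK.
Qed.

End Torsion.

(** * Finiteness of socles *)

Definition fin_pred (G : zmodType) (P : G -> Prop) : Prop :=
  exists s : seq G, forall x, P x -> x \in s.

Lemma fin_pred_sub (G : zmodType) (P Q : G -> Prop) :
  (forall x, P x -> Q x) -> fin_pred Q -> fin_pred P.
Proof. by move=> PQ [s sQ]; exists s => x /PQ /sQ. Qed.

(** A representative chosen in each class places [P] in finitely many translates of [U]. A relation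
    [R] covers both uses, cosets and fibres. *)
Lemma fin_pred_cover (G : zmodType) (T : eqType) (P U : G -> Prop) (F : seq T)
    (R : T -> G -> Prop) :
    (forall x, P x -> exists2 a, a \in F & R a x) ->
    (forall a x y, P x -> P y -> R a x -> R a y -> U (x - y)) ->
  fin_pred U -> fin_pred P.
Proof.
move=> PR RU [u uP].
have /choice[v vP] a : exists v, forall x, P x -> R a x -> P v /\ R a v.
  have [[v [Pv Rv]]|nv] := pselect (exists v, P v /\ R a v); first by exists v.
  by exists 0 => x Px Rx; case: nv; exists x.
exists [seq v a + b | a <- F, b <- u] => x Px.
have [a aF Rax] := PR x Px; have [Pv Rv] := vP a x Px Rax.
apply/allpairsP; exists (a, x - v a); rewrite /= subrKC; split=> //.
exact/uP/(RU a).
Qed.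

(** Dependent choice in which each term sees the list of all earlier ones; [ok] is the invariant
    that lets the construction continue. *)
Lemma dependent_sequence (G : zmodType) (ok : G -> Prop)
    (step : seq G -> G -> Prop) :
    (forall s : seq G, (forall x, x \in s -> ok x) -> exists2 y, ok y & step s y) ->
  exists y : nat -> G, forall i, ok (y i) /\ step (mkseq y i) (y i).
Proof.
move=> stepP.
have /choice[nxt nxtP] s :
    exists y, (forall x, x \in s -> ok x) -> ok y /\ step s y.
  have [/stepP[y oky sy]|nok] := pselect (forall x, x \in s -> ok x).
    by exists y.
  by exists 0 => /nok.
pose hist :=
  fix hist n := if n is n'.+1 then rcons (hist n') (nxt (hist n')) else [::].
pose y i := nxt (hist i).
have histE n : hist n = mkseq y n by elim: n => // n IHn; rewrite mkseqS -IHn.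
have okh n : forall x, x \in hist n -> ok x.
  elim: n => //= n IHn x; rewrite mem_rcons inE => /orP[/eqP ->|/IHn //].
  by have [] := nxtP _ IHn.
by exists y => i; rewrite -histE; apply/nxtP/okh.
Qed.

Definition span (G : zmodType) (s : seq G) (x : G) : Prop :=
  exists c : nat -> int, x = \sum_(j < size s) s`_j *~ c j.

Lemma span_mulrz (G : zmodType) (s : seq G) x k : span s x -> span s (x *~ k).
Proof.
move=> [c ->]; exists (fun j => c j * k); rewrite mulrz_suml.
by apply: eq_bigr => j _; rewrite mulrzA.
Qed.

Lemma fin_span (G : zmodType) (s : seq G) :
    (forall x, x \in s -> exists2 n, (0 < n)%N & x *+ n = 0) ->
  fin_pred (span s).
Proof.
elim: s => [_|x s IHs tors].
  by exists [:: 0] => y [c ->]; rewrite big_ord0 inE.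
have [t tP] : fin_pred (span s).
  by apply: IHs => y ys; apply: tors; rewrite inE ys orbT.
have [n n0 xn] := tors x (mem_head x s).
exists [seq x *+ i + b | i <- iota 0 n, b <- t] => y [c ->].
rewrite big_ord_recl; apply/allpairsP.
exists (`|(c 0%N %% n)%Z|%N, \sum_(j < size s) s`_j *~ c j.+1); split=> //=.
- have : (c 0%N %% n)%Z < n%:Z by apply: ltz_pmod; lia.
  have : 0 <= (c 0%N %% n)%Z by apply: modz_ge0; lia.
  by rewrite mem_iota; lia.
- by apply: tP; exists (fun j => c j.+1).
congr (_ + _); rewrite pmulrn gez0_abs ?modz_ge0 //; last by lia.
rewrite {1}(divz_eq (c 0%N) n) mulrzDr.
by rewrite (@mulrz_dvd _ x n) ?add0r // dvdz_mull.
Qed.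

Section PTorsion.

Variables (p : nat) (G : zmodType).
Hypothesis p_pr : prime p.

(** The terms of the filtration of [G[p]] by [p]-height. *)
Definition socle_height (m : nat) (x : G) : Prop :=
  x *+ p = 0 /\ exists g, x = g *+ (p ^ m).

(** The new entry [y] is a quotient by [p ^ m] of a socle element [v] outside [span s + qG]; such a
    [v] exists by counting. *)
Lemma indep_step (q m : nat) (s : seq G) :
    ~ fin_pred (socle_height m) ->
    fin_pred (fun x : G => x *+ p = 0 /\ exists g, x = g *+ q) ->
    (forall x, x \in s -> exists2 n, (0 < n)%N & x *+ n = 0) ->
  exists2 y : G, y *+ (p ^ m.+1) = 0 &
    forall (n : int) x g, span s x -> y *~ n = x + g *+ q -> ((p ^ m.+1)%N %| n)%Z.
Proof.
move=> infV finU /fin_span[F FP].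
have [v [[vp [y vy]] vN]] : exists v, socle_height m v /\
    ~ exists x g, span s x /\ v = x + g *+ q.
  apply: contrapT => nv; apply: infV.
  pose R (a v : G) := exists g, v = a + g *+ q.
  (* Otherwise finitely many cosets of [qG] would cover the infinite set, each meeting it in a
     translate of part of a finite one. *)
  apply: (fin_pred_cover (F := F) (R := R) _ _ finU).
    move=> v Vv; apply: contrapT => nF; apply: nv; exists v; split=> //.
    move=> [x [g [sx vE]]]; apply: nF; exists x; first exact: FP.
    by exists g.
  move=> a v w [vp _] [wp _] [g vE] [h wE]; split.
    by rewrite mulrnBl vp wp subrr.
  by exists (g - h); rewrite vE wE opprD addrACA subrr add0r mulrnBl.
have yp : y *+ (p ^ m.+1) = 0 by rewrite expnSr mulrnA -vy.
exists y => //.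
move=> n x g sx yE; apply: contrapT => ndvd; apply: vN.
(* If [p ^ m.+1] does not divide [n], Bezout makes [y *+ p ^ a], for some [a <= m], a multiple of
   [y *~ n]; then [v] lies in the excluded sum. *)
have /(dvdn_pfactor _ _ p_pr)[a le_am gcdE] :
    (gcdn `|n| (p ^ m.+1) %| p ^ m.+1)%N by apply: dvdn_gcdr.
have lt_am : (a <= m)%N.
  rewrite -ltnS ltn_neqAle le_am andbT; apply/eqP => am; apply: ndvd.
  by rewrite dvdzE /= -{1}am -gcdE dvdn_gcdl.
have [u w uwE _] := egcdzP n (p ^ m.+1)%N.
exists (x *~ u *~ (p ^ (m - a))%N), (g *~ u *~ (p ^ (m - a))%N); split.
  by do 2!apply: span_mulrz.
have yv : y *~ n *~ u = y *+ (p ^ a).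
  rewrite -mulrzA mulrC [in RHS]pmulrn.
  have -> : (p ^ a)%N%:Z = u * n + w * (p ^ m.+1)%N by rewrite uwE -gcdE.
  by rewrite mulrzDr (@mulrz_dvd _ y _ (w * _) yp) ?addr0 // dvdz_mull.
rewrite vy -(subnKC lt_am) expnD mulrnA -yv yE.
by rewrite !pmulrn !mulrzDl addKn !(mulrzAC _ q).
Qed.

Lemma indep_mod_bounded m :
    ~ fin_pred (socle_height m) -> fin_pred (socle_height m.+1) ->
  exists y : nat -> G, indep_mod (p ^ m.+1) y (fun=> p ^ m.+1)%N.
Proof.
move=> infV finV.
pose step (s : seq G) (y : G) := forall (n : int) x g, span s x ->
  y *~ n = x + g *+ (p ^ m.+1) -> ((p ^ m.+1)%N %| n)%Z.
have [s sok|y yP] := @dependent_sequence G (fun y => y *+ (p ^ m.+1) = 0) step.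
  apply: indep_step => // x /sok xp.
  by exists (p ^ m.+1)%N => //; rewrite expn_gt0 prime_gt0.
exists y; apply: indep_mod_of_step => [i|i n c g yE]; first by have [] := yP i.
have [_ /(_ n)] := yP i; apply; last exact: yE.
exists c; rewrite size_mkseq; apply: eq_bigr => j _.
by rewrite nth_mkseq.
Qed.

(** With [q = 0] the finiteness condition of [indep_step] is trivial, and the height can vary:
    taking the length of the history makes the orders grow. *)
Lemma indep_mod_unbounded :
    (forall m, ~ fin_pred (socle_height m)) ->
  exists y : nat -> G, indep_mod 0 y (fun i => p ^ i.+1)%N.
Proof.
move=> infV.
pose step (s : seq G) (y : G) := y *+ (p ^ (size s).+1) = 0 /\
  forall (n : int) x g, span s x ->
    y *~ n = x + g *+ 0 -> ((p ^ (size s).+1)%N %| n)%Z.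
have [s sok|y yP] := @dependent_sequence G
    (fun x => exists2 n, (0 < n)%N & x *+ n = 0) step.
  have [|y yp yP] := @indep_step 0%N (size s) s (infV _) _ sok.
    by exists [:: 0] => x [_ [g ->]]; rewrite mulr0n inE.
  exists y => //; exists (p ^ (size s).+1)%N => //.
  by rewrite expn_gt0 prime_gt0.
exists y; apply: indep_mod_of_step => [i|i n c g yE].
  by have [_ []] := yP i; rewrite size_mkseq.
have [_ [_ /(_ n)]] := yP i; rewrite size_mkseq; apply; last exact: yE.
exists c; rewrite size_mkseq; apply: eq_bigr => j _.
by rewrite nth_mkseq.
Qed.

(** If [G[p]] is infinite, its height filtration either stays infinite or drops at some step from
    infinite to finite; each case yields an excluded independent sequence. *)
Lemma semi_bassian_fin_socle :
  semi_bassian G -> fin_pred (fun x : G => x *+ p = 0).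
Proof.
move=> sbG; apply: contrapT => inf0.
have {}inf0 : ~ fin_pred (socle_height 0).
  apply: contra_not inf0; apply: fin_pred_sub => x xp; split=> //.
  by exists x; rewrite mulr1n.
have [[m finm]|nfin] := pselect (exists m, fin_pred (socle_height m)); last first.
  have [|y /(not_semi_bassian_of_unbounded p_pr)] := indep_mod_unbounded => //.
  by move=> m finm; apply: nfin; exists m.
elim: m finm => // m IHm finm; apply: IHm; apply: contrapT => infm.
have [y /(not_semi_bassian_of_bounded p_pr)] := indep_mod_bounded infm finm.
exact.
Qed.

End PTorsion.

(** * Lifting iterates *)

Definition p_torsion (p : nat) (G : zmodType) (x : G) : Prop :=
  exists k, x *+ (p ^ k) = 0.

Section NotBassian.

Variables (G : zmodType) (N : zmodClosed G) (f : {additive G -> Quotient.quot N}).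
Hypothesis f_inj : injective f.

(* Iterating a lift [g] of [f] from [x] in [N]: applying [f] shifts the sequence
   [x, g x, g (g x), ...], whose first term is killed modulo [N]. *)
Section Lift.

Variables (g : G -> G) (x : G).
Hypotheses (xN : x \in N)
  (gP : forall i, \pi_(Quotient.quot N) (iter i.+1 g x) = f (iter i g x)).

(** Modulo [N] a relation [h * 'X + c] loses its constant term and becomes the image under [f] of
    the relation [h]. By induction [h = 0], and then [x *~ c = 0] gives [c = 0]. *)
Lemma indep_mod_iter_lift :
    (forall n, (0 < n)%N -> x *+ n <> 0) ->
  indep_mod 0 (fun i => iter i g x) (fun=> 0%N).
Proof.
move=> xinf; split=> // h g0; rewrite mulr0n => h0 {g0}.
suff -> : h = 0 by move=> i; rewrite coef0 dvdz0.
elim/poly_ind: h h0 => // h c IHh; rewrite raddfD /= lincombMX lincombC /= => h0.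
have hz : h = 0.
  apply/IHh/f_inj; rewrite raddf0.
  have <- : \pi_(Quotient.quot N) (lincomb ((fun i => iter i g x) \o S) h)
      = f (lincomb (fun i => iter i g x) h).
    rewrite /lincomb !raddf_sum; apply: eq_bigr => i _.
    by rewrite !raddfMz /= -gP.
  apply/pi_quot_eq0; rewrite (canRL (addrK _) h0) sub0r rpredN.
  exact: rpredMz.
move: h0; rewrite hz mul0r raddf0 !add0r => xc.
suff -> : c = 0 by [].
apply: contrapT => /eqP c0; apply: (xinf `|c|%N); first by rewrite absz_gt0.
by rewrite pmulrn abszEsg mulrC mulrzA xc mul0rz.
Qed.

(** Injectivity of [f] cancels common iterations until [x] equals a later iterate. Modulo [N] this
    makes some iterate zero, and going back down gives [x = 0]. *)
Lemma iter_lift_inj : x <> 0 -> injective (fun i => iter i g x).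
Proof.
move=> x0; have ne j : forall i, iter i g x = iter (i + j.+1) g x -> False.
  elim => [|i IHi] ij; last first.
    by apply/IHi/f_inj; rewrite -!gP -addSn -ij.
  have : f (iter j g x) = 0 by rewrite -gP; apply/pi_quot_eq0; rewrite -ij.
  rewrite -(raddf0 f) => /f_inj.
  elim: j {ij} => [|j IHj] //; move=> gj0; apply/IHj/f_inj.
  by rewrite -gP gj0 !raddf0.
move=> i j /= ij; have [ltij|ltji|//] := ltngtP i j.
  by case: (ne (j - i.+1)%N i); rewrite addnS -addSn subnKC.
by case: (ne (i - j.+1)%N j); rewrite addnS -addSn subnKC.
Qed.

End Lift.

Lemma not_bassian_infinite_p_torsion :
    semi_bassian G -> ~ is_zero_subset N ->
  exists2 p, prime p & ~ fin_pred (@p_torsion p G).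
Proof.
move=> sbG N_neq0.
have lift y : exists z, \pi_(Quotient.quot N) z = f y.
  by exists (repr (f y)); apply: reprK.
(* An element of infinite order in [N] would start an independent sequence of elements of infinite
   order. *)
have tors x : x \in N -> exists2 n, (0 < n)%N & x *+ n = 0.
  move=> xN; apply: contrapT => nt.
  have [g gP] := choice lift.
  apply: not_semi_bassian_of_torsion_free sbG.
  apply: (indep_mod_iter_lift xN (fun i => gP (iter i g x))) => n n0 xn.
  by apply: nt; exists n.
have [x xN x0] : exists2 x, x \in N & x <> 0.
  apply: contrapT => nx; apply: N_neq0 => x; split=> [xN|->]; last exact: rpred0.
  by apply: contrapT => x0; apply: nx; exists x.
have exn : exists n, (0 < n)%N && (x *+ n == 0).
  by have [n n0 /eqP xn] := tors x xN; exists n; rewrite n0.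
have [n /andP[n0 /eqP xn] nmin] := ex_minnP exn.
have n1 : (1 < n)%N.
  by case: n n0 xn {nmin} => [|[|n]] // _; rewrite mulr1n => /x0.
pose p := pdiv n; have p_pr : prime p := pdiv_prime n1.
have np : n = (n %/ p * p)%N by rewrite divnK ?pdiv_dvd.
pose x' := x *+ (n %/ p).
have x'N : x' \in N by apply: rpredMn.
have x'p : x' *+ p = 0 by rewrite -mulrnA -np.
have x'0 : x' <> 0.
  move=> /eqP x'0; have := nmin (n %/ p)%N.
  rewrite x'0 divn_gt0 ?prime_gt0 // dvdn_leq ?pdiv_dvd // => /(_ isT).
  by rewrite leqNgt ltn_Pdiv ?prime_gt1.
exists p => // -[s sP].
have /choice[g gP] y : exists z, p_torsion p y ->
    p_torsion p z /\ \pi_(Quotient.quot N) z = f y.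
  have [[k yk]|ny] := pselect (p_torsion p y); last by exists 0.
  have [t tE] := lift y.
  have tN : t *+ (p ^ k) \in N.
    by apply/pi_quot_eq0; rewrite raddfMn /= tE -raddfMn yk raddf0.
  have [n' n'0 tn] := tors _ tN.
  pose M := (p ^ k * n')%N.
  have M0 : (0 < M)%N by rewrite muln_gt0 expn_gt0 prime_gt0.
  have tM : t *+ M = 0 by rewrite mulrnA.
  (* Multiplying [t] by an integer divisible by the prime-to-[p] part of [M] and congruent to 1
     modulo [p ^ k] makes it [p]-torsion, and changes it only by an element of [N]. *)
  have /coprimezP[[u v] /= uvE] : coprimez (M`_p^')%N (p ^ k)%N.
    rewrite coprimezE coprimeXr //=.
    by rewrite (p'nat_coprime (part_pnat _ _)) ?pnat_id.
  exists (t *~ (u * (M`_p^')%N)) => _; split.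
    exists (logn p M); rewrite pmulrn -mulrzA -mulrA -PoszM mulnC -p_part partnC //.
    by rewrite mulrC mulrzA -pmulrn tM mul0rz.
  rewrite -tE; apply/pi_quot_eq; rewrite -{2}[t]mulr1z -mulrzBr -uvE.
  by rewrite opprD addNKr mulrNz rpredN mulrC mulrzA -pmulrn rpredMz.
have tor i : p_torsion p (iter i g x').
  by elim: i => [|i IHi]; [exists 1%N; rewrite expn1 | have [] := gP _ IHi].
have inj : injective (fun i => iter i g x').
  by apply: (iter_lift_inj x'N _ x'0) => i; have [] := gP _ (tor i).
suff : ((size s).+1 <= size s)%N by rewrite ltnn.
rewrite -[X in (X <= _)%N](size_mkseq (fun i => iter i g x')).
apply: uniq_leq_size; first exact: mkseq_uniq.
by move=> y /mapP[i _ ->]; apply: sP.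
Qed.

End NotBassian.

(** * Infinite [p]-torsion with finite socle *)

Section Chain.

Variables (p : nat) (G : zmodType).

(** Multiplication by [p] maps each layer to the previous one, with fibres inside cosets of the
    socle. *)
Lemma fin_torsion_pow n :
    fin_pred (fun x : G => x *+ p = 0) ->
  fin_pred (fun x : G => x *+ (p ^ n) = 0).
Proof.
move=> fin1; elim: n => [|n [F FP]].
  by exists [:: 0] => x; rewrite mulr1n inE => ->.
apply: (fin_pred_cover (F := F) (R := fun a x => x *+ p = a) _ _ fin1) => [x|a x y].
  by rewrite expnS mulrnA => xp; exists (x *+ p) => //; apply: FP.
by move=> _ _ xa ya; rewrite mulrnBl xa ya subrr.
Qed.

Lemma socle_height_leq m n (x : G) :
  (m <= n)%N -> socle_height p n x -> socle_height p m x.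
Proof.
move=> mn [xp [g xE]]; split=> //; exists (g *+ (p ^ (n - m))).
by rewrite xE -mulrnA -expnD subnK.
Qed.

Lemma socle_height_stable : fin_pred (fun x : G => x *+ p = 0) ->
  exists n, forall k (x : G), socle_height p n x -> socle_height p k x.
Proof.
case=> s sP.
have /choice[h hP] (x : G) :
    exists n, socle_height p n x -> forall k, socle_height p k x.
  have [[n nx]|hx] := pselect (exists n, ~ socle_height p n x).
    by exists n => /nx.
  by exists 0%N => _ k; apply: contrapT => nk; apply: hx; exists k.
exists (\max_(x <- s) h x) => k x Vx; apply: (hP x).
by apply: (socle_height_leq _ Vx); apply: leq_bigmax_seq => //; apply: sP; case: Vx.
Qed.

(* The height filtration of the finite socle is eventually constant. If its limit
   is trivial the p-torsion is bounded, hence finite; otherwise the p-torsion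
   elements of height at least [n] form a nonzero divisible group. *)
Lemma exists_prufer_chain :
    fin_pred (fun x : G => x *+ p = 0) -> ~ fin_pred (@p_torsion p G) ->
  exists x : nat -> G,
    [/\ x 0%N <> 0, x 0%N *+ p = 0 & forall i, x i.+1 *+ p = x i].
Proof.
move=> fin1 infT; have [n stab] := socle_height_stable fin1.
pose P y := p_torsion p y /\ exists g : G, y = g *+ (p ^ n).
have [[w [wV w0]]|nw] :=
    pselect (exists w : G, socle_height p n w /\ w <> 0); last first.
  (* A socle element of the form [x *+ p ^ (n + k)] has height at least [n], hence vanishes;
     descending on [k], [p ^ n] kills the [p]-torsion. *)
  case: infT; apply: fin_pred_sub (fin_torsion_pow n fin1) => x [k xk].
  have {xk} : x *+ (p ^ (n + k)) = 0.
    by rewrite addnC expnD mulrnA xk mul0rn.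
  elim: k => [|k IHk]; first by rewrite addn0.
  rewrite addnS expnSr mulrnA => xp; apply: IHk; apply: contrapT => x0.
  apply: nw; exists (x *+ (p ^ (n + k))); split=> //; split=> //.
  by exists (x *+ (p ^ k)); rewrite -mulrnA -expnD addnC.
(* If [p ^ k.+1] kills [y], then [y *+ p ^ k] is a socle element of height at least [n], so by
   stability it is [t *+ p ^ (n.+1 + k)]; subtracting [t *+ p ^ n.+1] from [y] lowers the
   exponent. *)
have div y : P y -> exists h, y = h *+ (p ^ n.+1).
  move=> [[k yk] [g yE]]; elim: k y g yk yE => [|k IHk] y g yk yE.
    by exists 0; rewrite mul0rn -yk mulr1n.
  have [_ [t tE]] : socle_height p (n.+1 + k) (y *+ (p ^ k)).
    apply: stab; split; first by rewrite -mulrnA -expnSr.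
    by exists (g *+ (p ^ k)); rewrite yE -!mulrnA mulnC.
  have [||h hE] := IHk (y - t *+ (p ^ n.+1)) (g - t *+ p).
  - by rewrite mulrnBl tE expnD mulrnA subrr.
  - by rewrite mulrnBl yE -mulrnA -expnS.
  by exists (h + t); rewrite mulrnDl -hE subrK.
have /choice[z zP] y : exists z, P y -> P z /\ z *+ p = y.
  have [Py|nPy] := pselect (P y); last by exists 0.
  have [h yE] := div y Py; exists (h *+ (p ^ n)) => _.
  have zE : h *+ (p ^ n) *+ p = y by rewrite -mulrnA -expnSr.
  split=> //; split; last by exists h.
  by case: Py => -[k yk] _; exists k.+1; rewrite expnS mulrnA zE.
have Pi i : P (iter i z w).
  elim: i => [|i IHi]; last by have [] := zP _ IHi.
  by case: wV => wp hw; split=> //; exists 1%N; rewrite expn1.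
exists (fun i => iter i z w); split=> //; first by case: wV.
by move=> i; have [] := zP _ (Pi i).
Qed.

End Chain.

(** * Quasi-cyclic groups *)

Section Prufer.

Variable p : nat.
Hypothesis p_pr : prime p.

Let pX_neq0 k : (p ^ k)%N%:R != 0 :> rat.
Proof. by rewrite pnatr_eq0 -lt0n expn_gt0 prime_gt0. Qed.

Lemma Zinv_frac (z : int) k :
  exists a : Zinv p, val a * (p ^ k)%N%:R = z%:~R.
Proof.
have Vk : ((p ^ k)%N%:R^-1 : rat) \in pow_denom p.
  rewrite unfold_in /pow_denom pmulrn denqVz ?pnatX ?pnat_id //.
  by rewrite eqz_nat -lt0n expn_gt0 prime_gt0.
exists (MkZinv Vk *~ z).
by rewrite raddfMz /= -mulrzl mulfVK.
Qed.

Lemma Zinv_num_denom (a : Zinv p) :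
  exists k (z : int), val a * (p ^ k)%N%:R = z%:~R /\ ((0 < k)%N -> coprime p `|z|).
Proof.
have : p.-nat `|denq (val a)|%N by apply: (valP a).
case/p_natP=> k kE; exists k, (numq (val a)); split.
  by rewrite numqE -kE pmulrn gez0_abs ?denq_ge0.
move=> k0; have := coprime_num_den (val a).
by rewrite kE coprime_pexpr // coprime_sym.
Qed.

Let proj : {additive Zinv p -> prufer p} := \pi_(prufer p).

Let projK d : proj (repr d) = d.
Proof. exact: reprK. Qed.

Lemma pi_prufer_eq0 (a : Zinv p) :
  \pi_(prufer p) a = 0 <-> exists z : int, val a = z%:~R.
Proof.
rewrite pi_quot_eq0; split; first by move/intrP.
by move=> az; apply/intrP.
Qed.

Lemma mod_injective_prufer : mod_injective 0 (prufer p).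
Proof.
move=> n n0 _ d _; have [k [z [zE _]]] := Zinv_num_denom (repr d).
have /coprimezP[[u w] /= uwE] : coprimez (n`_p^')%N (p ^ k)%N.
  rewrite coprimezE coprimeXr //=.
  by rewrite (p'nat_coprime (part_pnat _ _)) ?pnat_id.
(* The [p]-part of [n] is absorbed into the denominator; its prime-to-[p] part is inverted modulo
   [p ^ k] by [u]. *)
have [b bE] := Zinv_frac (z * u) (k + logn p n).
exists (proj b *+ 1); rewrite mulr1n -raddfMn -[d]projK.
apply/esym/pi_quot_eq/intrP; exists (- (z * w)).
apply: (mulIf (pX_neq0 k)).
have nE : n%:R = (p ^ logn p n)%N%:R * (n`_p^')%N%:R :> rat.
  by rewrite -natrM -p_part partnC.
have uwQ : u%:~R * (n`_p^')%N%:R + w%:~R * (p ^ k)%N%:R = 1 :> rat.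
  by rewrite -(intrM _ u (Posz _)) -(intrM _ w (Posz _)) -intrD uwE.
rewrite raddfB raddfMn /= -[_ *+ n]mulr_natr nE.
transitivity (val b * ((p ^ k)%N%:R * (p ^ logn p n)%N%:R) * (n`_p^')%N%:R
  - val (repr d) * (p ^ k)%N%:R); first by rewrite /=; ring.
rewrite -natrM -expnD bE zE intrN !intrM.
transitivity (z%:~R * u%:~R * (n`_p^')%N%:R
  - z%:~R * (u%:~R * (n`_p^')%N%:R + w%:~R * (p ^ k)%N%:R) : rat).
  by rewrite uwQ mulr1.
by ring.
Qed.

(** The class of 1/p lies in every nonzero cyclic subgroup, so every nonzero subgroup is essential.
    For [x] the class of z/p^(k+1), the multiplier is [p ^ k] times an inverse of [z] modulo [p]. *)
Lemma prufer_socle (x : prufer p) (b : Zinv p) :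
  x <> 0 -> val b * p%:R = 1 -> exists w : int, x *~ w = proj b.
Proof.
rewrite -[x]projK; set a := repr x => a0 bE.
have [[|k] [z [zE zp]]] := Zinv_num_denom a.
  by case: a0; apply/pi_prufer_eq0; exists z; rewrite -zE mulr1.
have /coprimezP[[u w] /= uwE] : coprimez z p.
  by rewrite coprimezE coprime_sym zp.
exists (u * (p ^ k)%N); rewrite -raddfMz; apply/pi_quot_eq/intrP; exists (- w).
have uwQ : u%:~R * z%:~R + w%:~R * p%:R = 1 :> rat.
  by rewrite -intrM -(intrM _ w (Posz _)) -intrD uwE.
have p_neq0 : p%:R != 0 :> rat by rewrite pnatr_eq0 -lt0n prime_gt0.
apply: (mulIf p_neq0); rewrite raddfB raddfMz /= -mulrzr intrM.
transitivity (u%:~R * (val a * ((p ^ k)%N%:R * p%:R)) - val b * p%:R).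
  by rewrite -pmulrn /=; ring.
rewrite -natrM -expnSr zE bE intrN mulNr -[X in _ - X]uwQ.
by rewrite opprD addrA subrr sub0r.
Qed.

Lemma prufer_semi_bassian (G : zmodType) :
  isomorphic G (prufer p) -> semi_bassian G.
Proof.
move=> [h h_bij] N _; have h_inj := bij_inj h_bij.
have [[x [xN x0]]|nx] := pselect (exists x, x \in N /\ x <> 0); last first.
  left=> x; split=> [xN|->]; last exact: rpred0.
  by apply: contrapT => x0; apply: nx; exists x.
right=> S S0 NS0.
have [y [yS y0]] : exists y, y \in S /\ y <> 0.
  apply: contrapT => ny; apply: S0 => y; split=> [yS|->]; last exact: rpred0.
  by apply: contrapT => y0; apply: ny; exists y.
have h0 u : u <> 0 -> h u <> 0 by move=> u0 /eqP; rewrite raddf_eq0 // => /eqP.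
have [b bE] := Zinv_frac 1 1.
have {}bE : val b * p%:R = 1 by rewrite bE.
have [u uE] := prufer_socle (h0 x x0) bE.
have [w wE] := prufer_socle (h0 y y0) bE.
have xy : x *~ u = y *~ w by apply: h_inj; rewrite !raddfMz /= uE wE.
have /NS0 xu0 : x *~ u \in [predI N & S].
  by rewrite inE rpredMz //= xy rpredMz.
(* If the common multiple were 0, then 1/p would be an integer. *)
move: uE; rewrite -raddfMz xu0 raddf0 => /esym/pi_prufer_eq0[z zE].
move: bE; rewrite zE -(intrM _ z (Posz p)) => /(@intr_inj _ _ 1)/(congr1 absz).
rewrite abszM => /eqP; rewrite muln_eq1 => /andP[_ /eqP p1].
by have := p_pr; rewrite (p1 : p = 1%N).
Qed.

Section Chain.

Variables (G : zmodType) (x : nat -> G).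
Hypotheses (x0 : x 0%N <> 0) (x0p : x 0%N *+ p = 0).
Hypothesis xp : forall i, x i.+1 *+ p = x i.

(** The chain is shifted so that [X k] has order [p ^ k] and can be the image of 1/p^k. *)
Let X k := if k is k'.+1 then x k' else 0.

Let XD k j : X (k + j)%N *+ (p ^ j) = X k.
Proof.
elim: j => [|j IHj]; first by rewrite addn0 mulr1n.
rewrite addnS expnS mulrnA; case: (k + j)%N IHj => [|i] /=.
  by rewrite x0p mul0rn.
by rewrite xp.
Qed.

Let X_order k (z : int) : X k *~ z = 0 -> ((p ^ k)%N %| z)%Z.
Proof.
elim: k z => [|k IHk] z Xz; first by rewrite dvd1z.
have /IHk/dvdzP[w zE] : X k *~ z = 0.
  by rewrite -(XD k 1) addn1 expn1 pmulrn mulrzAC Xz mul0rz.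
move: Xz; rewrite zE mulrC mulrzA -pmulrn -add1n XD /= => xw.
rewrite expnSr PoszM dvdz_mul //; apply: contrapT => ndvd.
have /coprimezP[[u v] /= uvE] : coprimez w p.
  by rewrite coprimezE coprime_sym /= prime_coprime //; apply/negP.
apply: x0; rewrite -[LHS]mulr1z -uvE mulrzDr [u * w]mulrC (mulrzA _ w) xw mul0rz add0r.
by rewrite mulrC mulrzA -pmulrn x0p mul0rz.
Qed.

(** Fractions need not be reduced in this description, so additivity follows by passing to a common
    denominator. *)
Lemma chain_morphism : exists K : {additive Zinv p -> G},
  forall a k (z : int), val a * (p ^ k)%N%:R = z%:~R -> K a = X k *~ z.
Proof.
have /choice[K KP] (a : Zinv p) : exists g, forall k (z : int),
    val a * (p ^ k)%N%:R = z%:~R -> g = X k *~ z.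
  have [k [z [zE _]]] := Zinv_num_denom a; exists (X k *~ z) => l w wE.
  rewrite -(XD k l) -(XD l k) addnC !pmulrn -!mulrzA; congr (_ *~ _).
  apply: (@intr_inj rat); rewrite !intrM -zE -wE -!pmulrn.
  by rewrite /=; ring.
have KB : {morph K : a b / a - b}.
  move=> a b; have [k [z [zE _]]] := Zinv_num_denom a.
  have [l [w [wE _]]] := Zinv_num_denom b.
  rewrite (KP a (k + l)%N (z * (p ^ l)%N)); last first.
    by rewrite intrM -zE -pmulrn expnD natrM mulrA.
  rewrite (KP b (k + l)%N (w * (p ^ k)%N)); last first.
    by rewrite intrM -wE -pmulrn expnD natrM mulrCA mulrC.
  rewrite -mulrzBr; apply: KP; rewrite raddfB mulrBl !intrB !intrM -zE -wE.
  by rewrite -!pmulrn expnD natrM; ring.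
have [F FE] := additive_of_morph KB.
by exists F => a k z zE; rewrite FE; apply: KP.
Qed.

(* The subgroup generated by the chain is divisible; the quotient by its socle
   [N] is handled with [Theta = p Phi], and essentiality of [N] forces the
   extension [Phi] of the isomorphism with [prufer p] to be injective. *)
Lemma isomorphic_prufer_of_chain : semi_bassian G -> isomorphic G (prufer p).
Proof.
move=> sbG; have [K KP] := chain_morphism.
have K_eq0 a : K a = 0 <-> proj a = 0.
  split=> [Ka0|/pi_prufer_eq0[z zE]]; last first.
    by rewrite (KP a 0%N z) ?mulr1 // mul0rz.
  have [k [z [zE _]]] := Zinv_num_denom a.
  have /X_order/dvdzP[w wE] : X k *~ z = 0 by rewrite -(KP a).
  apply/pi_prufer_eq0; exists w; apply: (mulIf (pX_neq0 k)).
  by rewrite zE wE intrM pmulrn.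
have [Phi PhiE] : exists H : {additive G -> prufer p}, forall a, H (K a) = proj a.
  apply: (extend_additive mod_injective_prufer) => a g.
  by rewrite mulr0n => /K_eq0.
have [|Theta ThetaE] := @additive_of_morph G (prufer p) (fun y => Phi y *+ p).
  by move=> y z; rewrite raddfB mulrnBl.
have [|y z|N NE] :=
    @zmodClosed_of_prop G (fun y => exists2 a, y = K a & Theta y = 0).
- by exists 0; rewrite !raddf0.
- move=> [a -> Ta] [b -> Tb]; exists (a - b); first by rewrite raddfB.
  by rewrite raddfB Ta Tb subrr.
have [|y z|S SE] := @zmodClosed_of_prop G (fun y => Phi y = 0).
- exact: raddf0.
- by move=> y0 z0; rewrite raddfB y0 z0 subrr.
have : has_injection G (Quotient.quot N).
  apply: (embeds_in_quotient (Y := K) (Phi := Phi) (Theta := Theta)) => //.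
    move=> d; have [|e dE] := mod_injective_prufer (prime_gt0 p_pr) (dvdn0 p) (d := d).
      by rewrite div0n.
    by exists (repr e); rewrite ThetaE PhiE projK.
  by move=> a; rewrite PhiE => /K_eq0.
case/sbG => [N0|essN].
  (* [x 0] is the image of 1/p, which [Theta] sends to the class of 1, that is, to 0. *)
  case: x0; apply/N0/NE; have [a aE] := Zinv_frac 1 1.
  exists a; first by rewrite (KP a 1%N 1).
  rewrite ThetaE (_ : x 0%N = K a); last by rewrite (KP a 1%N 1).
  rewrite PhiE -raddfMn; apply/pi_prufer_eq0; exists 1.
  by rewrite raddfMn -aE mulr_natr.
have Phi_inj : injective Phi.
  apply: raddf_inj => y Phi0; apply: contrapT => y0; apply: (essN S).
    by move=> S0; apply/y0/S0/SE.
  move=> z; split=> [|->]; last by rewrite inE !rpred0.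
  rewrite inE => /andP[/NE[a -> _] /SE].
  by rewrite PhiE => /K_eq0.
(* [K] on representatives is a right inverse of [Phi]; injectivity makes it two-sided. *)
exists Phi; exists (fun d => K (repr d)) => [y|d]; last by rewrite PhiE projK.
by apply: Phi_inj; rewrite PhiE projK.
Qed.

End Chain.

End Prufer.

Theorem theorem2p4 (G : zmodType) :
  semi_bassian G <->
  (exists p : nat, prime p /\ isomorphic G (prufer p)) \/ bassian G.
Proof.
split=> [sbG|[[p [p_pr isoG]]|bG]]; last by move=> N /bG; left.
  have [bG|nbG] := pselect (bassian G); first by right.
  left; have [N [[f f_inj] N_neq0]] : exists N : zmodClosed G,
      has_injection G (Quotient.quot N) /\ ~ is_zero_subset N.
    apply: contrapT => nN; apply: nbG => N injN; apply: contrapT => N_neq0.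
    by apply: nN; exists N.
  have [p p_pr infp] := not_bassian_infinite_p_torsion f_inj sbG N_neq0.
  have finp := semi_bassian_fin_socle p_pr sbG.
  have [x [x0 x0p xp]] := exists_prufer_chain finp infp.
  by exists p; split=> //; apply: (isomorphic_prufer_of_chain p_pr x0 x0p xp).
exact: (prufer_semi_bassian p_pr isoG).
Qed.
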